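(* Let $X$ be a Hausdorff space, $U,V$ open subsets of $X$, and $X_b$ any section of $EX$ (given by $b:X\to EX$). Then (a) $U\subseteq\widehat{U}_b\subseteq cl\,U$; (b) $\widehat{U}_b=k[0U\cap X_b]$; (c) $(\widehat{U\cap V})_b=\widehat{U}_b\cap\widehat{V}_b$ and $(\widehat{U\cup V})_b=\widehat{U}_b\cup\widehat{V}_b$; (d) $X\setminus\widehat{U}_b=(\widehat{X\setminus cl_XU})_b$.
   Context: An open ultrafilter on a Hausdorff space $X$ is a maximal filter in the family of open subsets of $X$ (its members are nonempty open sets); it converges to $x\in X$ if it contains every open set containing $x$. $EX$ is the set of all convergent open ultrafilters on $X$, and $k:EX\to X$ sends each $\mathcal U\in EX$ to the unique point to which it converges. For $U$ open in $X$, $0U=\{\mathcal U\in EX: U\in\mathcal U\}$. Let $b:X\to EX$ be a function with $k\circ b=id_X$ (i.e. $b(x)$ is an open ultrafilter converging to $x$); the set $X_b=b[X]\subseteq EX$ is called a section of $EX$. For $U$ open, $\widehat{U}_b=\{x\in X: U\in b(x)\}$. *)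

(* Defs.v *)
From HB Require Import structures.
From mathcomp Require Import all_boot all_order.
From mathcomp Require Import boolp classical_sets filter topology.

Set Implicit Arguments.
Unset Strict Implicit.
Unset Printing Implicit Defensive.

Local Open Scope classical_set_scope.

(* A filter in the lattice of open sets: closure under supersets only concerns
   open supersets, so this is not a filter on [X] in the sense of [Filter]. *)
Record open_filter (X : topologicalType) (F : set_system X) : Prop := {
  open_filter_open : F `<=` open ;
  open_filterT : F setT ;
  open_filter_nonempty : forall U : set X, F U -> U !=set0 ;
  open_filterI : forall U V : set X, F U -> F V -> F (U `&` V) ;
  open_filterS : forall U V : set X, open V -> U `<=` V -> F U -> F V }.

Definition open_ultrafilter (X : topologicalType) (F : set_system X) : Prop :=
  open_filter F /\
  forall G : set_system X, open_filter G -> F `<=` G -> G = F.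

Definition open_converges (X : topologicalType) (F : set_system X) (x : X) :
  Prop := forall U : set X, open U -> U x -> F U.

Record EX (X : topologicalType) : Type := MkEX {
  EX_sets : set_system X ;
  EX_ultra : open_ultrafilter EX_sets ;
  EX_cvg : exists x : X, open_converges EX_sets x }.

(* [k] chooses a limit of [F]; when [X] is Hausdorff the limit is unique, so
   nothing depends on the choice (see [k_unique]). *)
Definition k (X : topologicalType) (F : EX X) : X := projT1 (cid (EX_cvg F)).

Lemma k_cvg (X : topologicalType) (F : EX X) : open_converges (EX_sets F) (k F).
Proof. exact: (projT2 (cid (EX_cvg F))). Qed.

Lemma k_unique (X : topologicalType) (hX : hausdorff_space X) (F : EX X)
  (x : X) : open_converges (EX_sets F) x -> k F = x.
Proof.
move=> Fx; apply: hX => A B.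
rewrite !nbhsE => -[A' [oA A'k] A'A] [B' [oB B'x] B'B].
have [Ff _] := EX_ultra F.
have FA := k_cvg oA A'k; have FB := Fx _ oB B'x.
have [y [yA yB]] := open_filter_nonempty Ff (open_filterI Ff FA FB).
by exists y; split; [exact: A'A|exact: B'B].
Qed.

Definition zeroE (X : topologicalType) (U : set X) : set (EX X) :=
  [set F : EX X | EX_sets F U].

Definition hat (X : topologicalType) (b : X -> EX X) (U : set X) : set X :=
  [set x : X | EX_sets (b x) U].

(* Main.v *)
Require Import Defs.
From HB Require Import structures.
From mathcomp Require Import all_boot all_order.
From mathcomp Require Import boolp classical_sets filter topology.

Set Implicit Arguments.
Unset Strict Implicit.
Unset Printing Implicit Defensive.

Local Open Scope classical_set_scope.

(* By maximality, an open set [U] meeting every member of an open ultrafilter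
   [F] belongs to [F]. Hence if [U] is not in [F], some open member of [F]
   misses [U], and thus lies in the complement of [closure U]. So [F] contains
   exactly one of [U] and [~` closure U], which gives (d) and primeness; the
   rest follows from [b x] converging to [x]. *)

(** The open supersets of the traces [A]&[U], with [A] in [F], form an open filter [G] that contains
    both [F] and [U]; maximality forces [G = F]. *)
Lemma open_ultrafilter_meets (X : topologicalType) (F : set_system X)
    (U : set X) :
  open_ultrafilter F -> open U -> (forall A, F A -> A `&` U !=set0) -> F U.
Proof.
move=> [Ff Fmax] oU meetU.
pose G : set_system X := [set W | open W /\ exists2 A, F A & A `&` U `<=` W].
have Gf : open_filter G.
  split=> [W []//||W [_ [A FA AUW]]|W1 W2 [o1 [A1 F1 s1]] [o2 [A2 F2 s2]]
    |W W' oW' sW [_ [A FA AUW]]].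
  - by split; [exact: openT|exists setT; [exact: open_filterT Ff|]].
  (* The meeting hypothesis is what makes [G] proper: [W] contains a nonempty trace. *)
  - by have [x /AUW Wx] := meetU _ FA; exists x.
  - split; first exact: openI.
    exists (A1 `&` A2); first exact: open_filterI.
    by move=> x [[A1x A2x] Ux]; split; [exact: s1|exact: s2].
  - by split=> //; exists A => //; exact: subset_trans AUW sW.
have FG : F `<=` G.
  move=> A FA; split; first exact: open_filter_open Ff _ FA.
  by exists A => // x [].
rewrite -(Fmax G Gf FG); split=> //.
by exists setT; [exact: open_filterT Ff|move=> x []].
Qed.

Lemma open_filter_disjointN (X : topologicalType) (F : set_system X)
    (U V : set X) :
  open_filter F -> U `&` V = set0 -> F U -> ~ F V.
Proof.
move=> Ff UV0 FU FV.
by have := open_filter_nonempty Ff (open_filterI Ff FU FV); rewrite UV0 => -[].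
Qed.

Lemma open_setC_closure (X : topologicalType) (U : set X) :
  open (~` closure U).
Proof. by apply: closed_openC; exact: closed_closure. Qed.

Lemma setI_setC_closure (X : topologicalType) (U : set X) :
  U `&` ~` closure U = set0.
Proof. by apply/disjoints_subset; rewrite setCK; exact: subset_closure. Qed.

Lemma open_ultrafilterC (X : topologicalType) (F : set_system X) (U : set X) :
  open_ultrafilter F -> open U -> ~ F U <-> F (~` closure U).
Proof.
move=> Fu oU; have [Ff _] := Fu; split=> [nFU|FcU FU]; last first.
  exact: (open_filter_disjointN Ff (setI_setC_closure U) FU FcU).
have [A FA AU0] : exists2 A, F A & A `&` U = set0.
  apply: contrapT => nA; apply: nFU; apply: open_ultrafilter_meets => // A FA.
  by apply/set0P/eqP => AU0; apply: nA; exists A.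
(* Since [A] is open, it is a neighbourhood of each of its points, so a point of [A] in [closure U]
   would make [A] meet [U]. *)
apply: (open_filterS Ff _ _ FA) => [|x Ax]; first exact: open_setC_closure.
move=> /(_ A (open_nbhs_nbhs (conj (open_filter_open Ff FA) Ax))).
by rewrite setIC AU0 => -[].
Qed.

Lemma open_ultrafilterU (X : topologicalType) (F : set_system X)
    (U V : set X) :
  open_ultrafilter F -> open U -> open V -> F (U `|` V) -> F U \/ F V.
Proof.
move=> Fu oU oV FUV; have [Ff _] := Fu.
have [FU|/(open_ultrafilterC Fu oU) FcU] := pselect (F U); first by left.
right; apply: (open_filterS Ff oV _ (open_filterI Ff FUV FcU)) => x.
by move=> [[Ux|//] /(_ (subset_closure Ux))].
Qed.

Theorem proposition2p3 (X : topologicalType) (hX : hausdorff_space X)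
  (U V : set X) (oU : open U) (oV : open V)
  (b : X -> EX X) (kb : @k X \o b = id) :
  [/\ U `<=` hat b U /\ hat b U `<=` closure U,
      hat b U = @k X @` (zeroE U `&` range b),
      hat b (U `&` V) = hat b U `&` hat b V /\
        hat b (U `|` V) = hat b U `|` hat b V
    & ~` hat b U = hat b (~` closure U)].
Proof.
have kbE x : k (b x) = x by exact: (congr1 (@^~ x) kb).
have bu x : open_ultrafilter (EX_sets (b x)) := EX_ultra (b x).
have bf x : open_filter (EX_sets (b x)) := (bu x).1.
have bcvg x : open_converges (EX_sets (b x)) x.
  (* Only the limit point is rewritten as [k (b x)]; the filter [b x] stays as it is. *)
  by rewrite -[X in open_converges _ X]kbE; exact: k_cvg.
split.
- split=> [x Ux|x bU]; first exact: bcvg.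
  apply: contrapT => /(bcvg _ _ (open_setC_closure U)).
  by move=> /(open_ultrafilterC (bu x) oU).
- apply/seteqP; split=> [x bU|_ [F [FU [x _ bxF]] <-]].
    by exists (b x) => //; split=> //; exists x.
  (* A point of the section has the form [b x], and [k] sends it back to [x]. *)
  by move: FU; rewrite -bxF kbE.
- split; apply/seteqP; split=> x.
  + by move=> bUV; split; apply: (open_filterS (bf x) _ _ bUV) => // y [].
  + by move=> [bU bV]; exact: open_filterI (bf x) _ _ bU bV.
  + exact: open_ultrafilterU.
  + by move=> [] bW; apply: (open_filterS (bf x) _ _ bW);
      [exact: openU|move=> y; left|exact: openU|move=> y; right].
- by apply/seteqP; split=> x /(open_ultrafilterC (bu x) oU).
Qed.
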